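(* Let $0<\varepsilon<\frac{1}{16}$. There is no deterministic comparison-based data structure for the Estimating Rank problem which stores $o\!\left(\frac{1}{\varepsilon}\log(\varepsilon N)\right)$ items on every input stream of length $N$.
   Context: Items come from a totally ordered universe $U$ which is unbounded and continuous: every non-empty open interval of $U$ contains arbitrarily many items. Estimating Rank problem: a stream of $N$ items from $U$ is processed in one pass; afterwards, for any query $q\in U$, the data structure must return the number of stream items not larger than $q$, up to an additive error of $\pm\varepsilon N$. A deterministic data structure $\mathcal{D}$ is comparison-based if: (i) it performs no operation on stream items other than comparisons and equality tests; (ii) its memory is split into an item array $I$, storing only items that have already occurred in the stream (kept sorted non-decreasingly, indexed from 1), and a general memory $G$ containing no item identifiers; once an item is removed from $I$ it cannot be added back unless it appears again in the stream; (iii) on arrival of an item $a_i$, its computation is determined solely by the results of comparisons between $a_i$ and $I[j]$ for $j=1,\dots,|I|$, by $|I|$, and by $G$; (iv) given a query $q\in U$, its computation is determined solely by the results of comparisons between $q$ and $I[j]$ for $j=1,\dots,|I|$, by $|I|$, and by $G$. Space is measured as the number of items stored in $I$. *)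

(* Defs.v *)
From HB Require Import structures.
From mathcomp Require Import all_boot all_order all_algebra.
From mathcomp Require Import all_classical all_reals all_analysis.

Set Implicit Arguments.
Unset Strict Implicit.
Unset Printing Implicit Defensive.

Import Order.TTheory GRing.Theory Num.Theory.

Local Open Scope ring_scope.

(* Non-emptiness is stated separately: the empty order satisfies the other
   clauses vacuously. *)
Definition unbounded_continuous (d : Order.disp_t) (U : orderType d) : Prop :=
  [/\ inhabited U,
      forall x : U, exists y, (y < x)%O,
      forall x : U, exists y, (x < y)%O
    & forall (x y : U) (n : nat), (x < y)%O ->
        exists s : seq U,
          [/\ uniq s, size s = n & forall z, z \in s -> (x < z < y)%O]].

Definition cmp (d : Order.disp_t) (U : orderType d) (x y : U) : comparison :=
  if (x < y)%O then Lt else if x == y then Eq else Gt.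

Definition cmps (d : Order.disp_t) (U : orderType d) (x : U) (A : seq U) :
    seq comparison :=
  [seq cmp x y | y <- A].

(* The record does not mention the universe.  Its functions receive only the
   general memory and the comparisons of the new (or queried) item with
   the item array A, a sequence whose length is |A|; hence no item can leak
   into the general memory.  The initial general memory may depend on the
   length N of the stream.
   [item_update] names the contents of the next item array: a (0-based) index
   j < |A| refers to the stored item at that position, and any j >= |A| to the
   arriving item.  Thus a discarded item is lost until it arrives again. *)
Record comparison_based (R : Type) := ComparisonBased {
  gmem : Type;
  gmem_init : nat -> gmem;
  gmem_update : gmem -> seq comparison -> gmem;
  item_update : gmem -> seq comparison -> seq nat;
  answer : gmem -> seq comparison -> R
}.

Section Execution.
Context {R : Type} (D : comparison_based R) {d : Order.disp_t} {U : orderType d}.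

Definition step (st : seq U * gmem D) (a : U) : seq U * gmem D :=
  let: (A, G) := st in
  let c := cmps a A in
  (sort <=%O [seq nth a A j | j <- item_update G c], gmem_update G c).

(* [N] is the length of the whole stream; [s] may be a proper prefix of it. *)
Definition run (N : nat) (s : seq U) : seq U * gmem D :=
  foldl step ([::], gmem_init D N) s.

Definition run_query (s : seq U) (q : U) : R :=
  let: (A, G) := run (size s) s in answer G (cmps q A).

End Execution.

Definition estimates_rank (R : realType) (eps : R) (d : Order.disp_t)
    (U : orderType d) (D : comparison_based R) : Prop :=
  forall (s : seq U) (q : U),
    `|run_query D s q - (count (fun x => (x <= q)%O) s)%:R|
      <= eps * (size s)%:R.

(* Space is the size of the item array at its largest, i.e. over all
   prefixes of the stream. *)
Definition stores_at_most (R : realType) (d : Order.disp_t) (U : orderType d)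
    (D : comparison_based R) (f : nat -> R) : Prop :=
  forall (s : seq U) (i : nat), (i <= size s)%N ->
    (size (run D (size s) (take i s)).1)%:R <= f (size s).

(* Main.v *)
Require Import Defs.
From HB Require Import structures.
From mathcomp Require Import all_boot all_order all_algebra.
From mathcomp Require Import all_classical all_reals all_analysis.
From mathcomp Require Import zify ring lra.

Set Implicit Arguments.
Unset Strict Implicit.
Unset Printing Implicit Defensive.

Import Order.TTheory GRing.Theory Num.Theory.
Import numFieldNormedType.Exports.

(* Feed the data structure two streams at once, as one stream of pairs, in such
   a way that it cannot tell them apart: each new pair lies in a pair of
   intervals containing no stored item, on matching sides of every stored pair.
   A gap of width [g] is such a pair of intervals whose ranks in the two streams
   differ by [g]; querying inside it shows that [g <= 2 eps N].
   The adversary for [2 ^ k * n] items runs the adversary for half as many items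
   twice, the second time inside the gap left by the first run, so that the
   widths [g1] and [g2] of the two gaps add up.  If [s] is the number of items
   stored from the interval at a suitable moment, then
     k * 2 ^ k * n <= 8 * g * (s + k).
   Indeed, either [g1] is notably less than half of [g], and the first run
   already forced enough space, or [g2] is not much more than half of [g], and
   to the space forced by the second run are added the items of the first run,
   of which about [2 ^ k * n / (4 g)] are kept, since the final width is [g].
   Hence [k <= 16 eps (s + k)], where [16 eps < 1], so [s] grows linearly in
   [k], which is of order [ln N] for [n = 4 ^ k]. *)

(** * Arithmetic of the recursion *)

Lemma space_gap_arith k n1 g g1 g2 s1 s2 m : g1 + g2 <= g -> 0 < g1 ->
    k * n1 <= 8 * g1 * (s1 + k) -> k * n1 <= 8 * g2 * (s2 + k) ->
    n1 <= (m + 2) * g + m ->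
  k.+1 * (2 * n1) <= 8 * g * (s1 + k.+1) \/
  k.+1 * (2 * n1) <= 8 * g * (s2 + m + k.+1).
Proof.
move=> leg g1_gt0 le1 le2 len1.
have g_gt0 : 0 < g by lia.
have len1m : n1 <= 2 * g * m.+1.
  have : m <= g * m by rewrite leq_pmull.
  lia.
(* The threshold [k g / (2 (k + 1))] for [g1] is what the first alternative needs; above it, [g2] is
   at most [(k + 2) g / (2 (k + 1))]. For [k = 0] the first case contradicts [0 < g1]. *)
have [small|large] := leqP (2 * k.+1 * g1) (k * g).
  left; case: k => [|k] in le1 le2 small *; first by lia.
  rewrite -(leq_pmul2l (ltn0Sn k)).
  have := leq_mul (leqnn (2 * k.+2)) le1.
  have := leq_mul small (leqnn (8 * (s1 + k.+1))).
  have : k.+1 * (8 * g * (s1 + k.+2)) =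
         k.+1 * g * (8 * (s1 + k.+1)) + k.+1 * (8 * g) by lia.
  lia.
right; rewrite -(leq_pmul2l (ltn0Sn k.+1)).
have g2_le : 2 * k.+1 * g2 <= k.+2 * g.
  have : 2 * k.+1 * g2 + 2 * k.+1 * g1 <= 2 * k.+1 * g.
    by rewrite -mulnDr leq_mul2l addnC leg orbT.
  lia.
(* The first two inequalities are chained and the third is added; the slack is
   [k (k + 1) + 2 (k + 2) >= (k + 1) (k + 2)]. *)
have := leq_mul (leqnn (2 * k.+1)) le2.
have := leq_mul g2_le (leqnn (8 * (s2 + k))).
have := leq_mul (leqnn (4 * k.+2)) len1m.
nia.
Qed.

(** * Indistinguishable streams, run as one stream of pairs *)

Section PairMachine.
Context {R : Type} (D : comparison_based R).
Context {d : Order.disp_t} {U : orderType d}.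
Variable N : nat.
Implicit Types (w M : seq (U * U)) (x p q c l r : U * U).
Local Open Scope order_scope.

Definition le_fst : rel (U * U) := relpre fst <=%O.

Definition coherent M :=
  {in M &, forall p q, (p.1 <= q.1) = (p.2 <= q.2)}.

(** All decisions, including the sorting, use first components only; second components are carried
    along. *)
Definition pair_step (st : seq (U * U) * gmem D) x : seq (U * U) * gmem D :=
  let: (M, G) := st in
  let c := cmps x.1 (unzip1 M) in
  (sort le_fst [seq nth x M j | j <- item_update G c], gmem_update G c).

Definition pair_run w := foldl pair_step ([::], gmem_init D N) w.
Definition stored w := (pair_run w).1.

(** The first projection is always a run, by [run_unzip1], so a condition is put on the second one
    only. Coherence concerns the memory alone, since discarded pairs are never compared again. *)
Definition twin w :=
  run D N (unzip2 w) = (unzip2 (stored w), (pair_run w).2)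
  /\ coherent (stored w).

Lemma pair_run_rcons w x : pair_run (rcons w x) = pair_step (pair_run w) x.
Proof. exact: foldl_rcons. Qed.

Lemma run_unzip1 w :
  run D N (unzip1 w) = (unzip1 (stored w), (pair_run w).2).
Proof.
elim/last_ind: w => [//|w x IH].
rewrite /stored pair_run_rcons /run /unzip1 map_rcons foldl_rcons.
rewrite -/(unzip1 w) -/(run D N (unzip1 w)) IH /stored /pair_step.
case: (pair_run w) => M G /=; congr pair.
rewrite -[RHS]sort_map; congr (sort _ _).
rewrite -map_comp; apply: eq_map => j /=.
by elim: M j => [|p M IHM] [|j] /=.
Qed.

Lemma stored_cat w v : {subset stored (w ++ v) <= stored w ++ v}.
Proof.
elim/last_ind: v => [|v x IH] p; first by rewrite cats0 cats0.
rewrite -rcons_cat /stored pair_run_rcons /pair_step.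
have := IH; rewrite /stored; case: (pair_run (w ++ v)) => M G /= IHM.
rewrite mem_sort => /mapP[j _ ->].
rewrite -rcons_cat mem_rcons inE.
have [ltj|lej] := ltnP j (size M).
  by rewrite IHM ?orbT // mem_nth.
by rewrite nth_default ?eqxx.
Qed.

Lemma coherent_cmp M x y : coherent M -> x \in M -> y \in M ->
  cmp x.1 y.1 = cmp x.2 y.2.
Proof.
move=> cohM Mx My; rewrite /cmp !ltNge cohM //.
by rewrite !eq_le cohM // (cohM y x).
Qed.

(** Coherence with the new pair makes both streams see the same comparisons, hence perform the same
    update; sorting by first components then also sorts the second ones. *)
Lemma twin_rcons w x : twin w -> coherent (x :: stored w) -> twin (rcons w x).
Proof.
case=> run2 _; rewrite /twin /stored pair_run_rcons /pair_step.
rewrite /run /unzip2 map_rcons foldl_rcons -/(unzip2 w) -/(run D N (unzip2 w)).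
rewrite run2 /stored; case: (pair_run w) => M G /= coh.
have -> : cmps x.2 (unzip2 M) = cmps x.1 (unzip1 M).
  rewrite /cmps /unzip1 /unzip2 -!map_comp; apply/eq_in_map => p Mp /=.
  by apply/esym/(coherent_cmp coh); rewrite inE ?eqxx ?Mp ?orbT.
set L := [seq nth x M j | j <- _].
have subL : {subset L <= x :: M}.
  move=> p /mapP[j _ ->]; rewrite inE.
  have [ltj|lej] := ltnP j (size M); first by rewrite mem_nth ?orbT.
  by rewrite nth_default ?eqxx.
have cohL : coherent (sort le_fst L).
  by move=> p q; rewrite !mem_sort => /subL p_in /subL q_in; apply: coh.
split=> //; congr pair.
have -> : [seq nth x.2 (unzip2 M) j | j <- item_update G (cmps x.1 (unzip1 M))]
          = unzip2 L.
  rewrite /L /unzip2 -map_comp; apply: eq_map => j /=.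
  by elim: (M) j => [|p M' IHM] [|j] /=.
apply: (@sorted_eq _ <=%O le_trans le_anti).
- exact: (sort_sorted (@le_total _ U)).
- rewrite sorted_map.
  have: sorted le_fst (sort le_fst L).
    by apply: sort_sorted => p q; apply: le_total.
  apply: (@sub_in_sorted _ (mem (sort le_fst L)) le_fst); last exact/allP.
  by move=> p q p_in q_in /=; rewrite /le_fst /= (cohL p q).
- rewrite (perm_trans (y := unzip2 L)) ?perm_sort //.
  by apply: perm_map; rewrite perm_sym perm_sort.
Qed.

Definition pair_le p q := (p.1 <= q.1) && (p.2 <= q.2).
Definition pair_lt p q := (p.1 < q.1) && (p.2 < q.2).

Definition inside l r x := (l.1 < x.1 < r.1) && (l.2 < x.2 < r.2).

Definition separates l r M := forall p, p \in M ->
  pair_le p l || pair_le r p.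

(** Unlike in [separates], the two components of an item may lie on opposite sides; such items are
    what gives a gap its width. *)
Definition avoids l r w := forall x, x \in w ->
  ~~ (l.1 < x.1 < r.1) && ~~ (l.2 < x.2 < r.2).

(** Pairs inside the interval lie on matching sides of the old memory and are coherent among
    themselves, and by [stored_cat] nothing else is ever compared with them. *)
Lemma twin_cat w v l r : twin w -> separates l r (stored w) ->
  {in v, forall x, inside l r x} -> coherent v -> twin (w ++ v).
Proof.
move=> tw sep ins coh.
have cohw := tw.2.
elim/last_ind: v => [|v x IH] in ins coh *; first by rewrite cats0.
rewrite -rcons_cat; apply: twin_rcons.
  apply: IH => [y vy|y z vy vz].
    by apply: ins; rewrite mem_rcons inE vy orbT.
  by apply: coh; rewrite mem_rcons inE ?vy ?vz orbT.
have cohA : coherent (stored w ++ rcons v x).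
  have mixed p y : p \in stored w -> y \in rcons v x ->
      ((p.1 <= y.1) = (p.2 <= y.2)) * ((y.1 <= p.1) = (y.2 <= p.2)).
    move=> /sep p_in /ins /andP[/andP[ly1 yr1] /andP[ly2 yr2]].
    case/orP: p_in => /andP[p1 p2].
      have lt1 := le_lt_trans p1 ly1; have lt2 := le_lt_trans p2 ly2.
      by rewrite (ltW lt1) (ltW lt2) !(lt_geF lt1, lt_geF lt2).
    have lt1 := lt_le_trans yr1 p1; have lt2 := lt_le_trans yr2 p2.
    by rewrite (ltW lt1) (ltW lt2) !(lt_geF lt1, lt_geF lt2).
  move=> p q; rewrite !mem_cat => /orP[Mp|vp] /orP[Mq|vq].
  - exact: cohw.
  - exact: (mixed p q Mp vq).1.
  - exact: (mixed q p Mq vp).2.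
  - exact: coh.
have sub : {subset x :: stored (w ++ v) <= stored w ++ rcons v x}.
  move=> p; rewrite inE mem_cat mem_rcons inE => /orP[->|/stored_cat].
    by rewrite orbT.
  by rewrite mem_cat => /orP[]->; rewrite ?orbT.
by move=> p q /sub p_in /sub q_in; apply: cohA.
Qed.
End PairMachine.

(** * Gaps and their widths *)

Section Gaps.
Context {d : Order.disp_t} {U : orderType d}.
Implicit Types (w M T : seq (U * U)) (x p q c l r : U * U).
Local Open Scope order_scope.

Definition count_le1 (a : U) w := count (fun x => x.1 <= a) w.
Definition count_le2 (a : U) w := count (fun x => x.2 <= a) w.
Definition count_lt2 (a : U) w := count (fun x => x.2 < a) w.

(** By [gap_avoids] the ranks do not vary within the two intervals, so measuring the width at the
    left ends is no restriction. *)
Record is_gap l r w M (g : nat) l' r' : Prop := IsGap {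
  gap_left : pair_le l l';
  gap_right : pair_le r' r;
  gap_lt : pair_lt l' r';
  gap_separates : separates l' r' M;
  gap_avoids : avoids l' r' w;
  gap_width : count_le2 l'.2 w = (count_le1 l'.1 w + g)%N }.

(** The successor is due to [p] itself, which is counted on the left when it occurs in [w], but not
    on the right. *)
Definition rank_dominated l r w M := forall p, p \in M -> inside l r p ->
  (count_le1 p.1 w <= (count_lt2 p.2 w).+1)%N.

Lemma next_above (a b : U) (s : seq U) : a < b ->
  exists z, [/\ a < z, z <= b & forall u, u \in s -> (u <= a) || (z <= u)].
Proof.
move=> ab; elim: s => [|y s [z [az zb zs]]]; first by exists b.
have [ya|ay] := leP y a.
  by exists z; split=> // x; rewrite inE => /predU1P[->|/zs //]; rewrite ya.
exists (Order.min y z); split; rewrite ?lt_min ?ay ?az ?ge_min ?zb ?orbT //.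
move=> x; rewrite inE => /predU1P[->|/zs]; rewrite ge_min ?lexx ?orbT //.
by case/orP=> ->; rewrite ?orbT.
Qed.

Lemma next_below (a b : U) (s : seq U) : a < b ->
  exists z, [/\ a <= z, z < b & forall u, u \in s -> (u <= z) || (b <= u)].
Proof.
move=> ab; elim: s => [|y s [z [az zb zs]]]; first by exists a.
have [yb|by_] := leP b y.
  exists z; split=> // x; rewrite inE => /predU1P[->|/zs //].
  by rewrite yb orbT.
exists (Order.max y z); split; rewrite ?gt_max ?by_ ?zb ?le_max ?az ?orbT //.
move=> x; rewrite inE => /predU1P[->|/zs]; rewrite le_max ?lexx //.
by case/orP=> ->; rewrite ?orbT.
Qed.

(** To make the ranks differ as much as possible, the first interval is shrunk to just above [c.1]
    and the second to just below [q.2]. *)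
Lemma gap_between l r M w c q g :
    pair_le l c -> pair_le q r -> pair_lt c q -> separates c q M ->
    count_lt2 q.2 w = (count_le1 c.1 w + g)%N ->
  exists l' r', is_gap l r w M g l' r'.
Proof.
move=> /andP[lc1 lc2] /andP[qr1 qr2] /andP[cq1 cq2] sep wid.
have [z1 [cz1 zq1 z1w]] := next_above (unzip1 w) cq1.
have [z2 [cz2 zq2 z2w]] := next_below (unzip2 w) cq2.
exists (c.1, z2), (z1, q.2); split=> /=.
- by rewrite /pair_le lc1 (le_trans lc2).
- by rewrite /pair_le qr2 (le_trans zq1).
- by rewrite /pair_lt cz1 zq2.
- move=> p /sep /orP[] /andP[p1 p2] /=.
    by rewrite /pair_le p1 (le_trans p2).
  by rewrite /pair_le p2 (le_trans zq1) // orbT.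
- move=> x wx /=.
  have /orP := z1w _ (map_f fst wx); have /orP := z2w _ (map_f snd wx).
  by case=> /le_gtF->; case=> /le_gtF->; rewrite ?andbF.
rewrite -wid; apply: eq_in_count => x wx /=.
have := z2w _ (map_f snd wx).
have [xz _|zx /=] := leP x.2 z2; first by rewrite (le_lt_trans xz zq2).
by move=> /le_gtF->.
Qed.

Lemma count_le1_avoids l r w a : avoids l r w -> l.1 <= a -> a < r.1 ->
  count_le1 a w = count_le1 l.1 w.
Proof.
move=> av la ar; apply: eq_in_count => x /av /andP[+ _] /=.
rewrite negb_and -!leNgt => /orP[xl|rx]; first by rewrite xl (le_trans xl).
have ax := lt_le_trans ar rx.
by rewrite (lt_geF ax) (lt_geF (le_lt_trans la ax)).
Qed.

Lemma count_le2_avoids l r w a : avoids l r w -> l.2 <= a -> a < r.2 ->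
  count_le2 a w = count_le2 l.2 w.
Proof.
move=> av la ar; apply: eq_in_count => x /av /andP[_ +] /=.
rewrite negb_and -!leNgt => /orP[xl|rx]; first by rewrite xl (le_trans xl).
have ax := lt_le_trans ar rx.
by rewrite (lt_geF ax) (lt_geF (le_lt_trans la ax)).
Qed.

Lemma count_lt2_avoids l r w a : avoids l r w -> l.2 < a -> a < r.2 ->
  count_lt2 a w = count_le2 l.2 w.
Proof.
move=> av la ar; apply: eq_in_count => x /av /andP[_ +] /=.
rewrite negb_and -!leNgt => /orP[xl|rx]; first by rewrite xl (le_lt_trans xl).
have ax := lt_le_trans ar rx.
by rewrite (lt_gtF ax) (lt_geF (lt_trans la ax)).
Qed.

Lemma le_fst_trans : transitive (@le_fst d U).
Proof. by move=> ? ? ?; apply: le_trans. Qed.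

(** * Pigeonhole principle for consecutive stored pairs *)

Section Pigeonhole.
(** Intended are [count_le1] at the left end and [count_lt2] at the right end of a gap between
    neighbours, with [h] the largest width allowed. *)
Variables (e f : U * U -> nat) (B : pred (U * U)) (z : U) (l r : U * U).
Variables (h : nat) (T0 : seq (U * U)).
Hypothesis e_fst : forall c q, c.1 = q.1 -> e c = e q.
Hypothesis narrow : forall c q, c \in l :: T0 -> q \in r :: T0 -> c.1 < q.1 ->
  {in T0, forall p, (p.1 <= c.1) || (q.1 <= p.1)} -> (f q <= e c + h)%N.
Hypothesis lt_r : {in l :: T0, forall p, p.1 < r.1}.
Hypothesis dominated : {in T0, forall q, ~~ B q -> e q <= (f q).+1}%N.
Hypothesis block_dominated : {in T0, forall q, B q -> e q <= f q}%N.
Hypothesis block_gt : {in T0, forall q, B q -> z < q.1}.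
Hypothesis block_const : {in l :: T0 & T0, forall c q, B q ->
  c.1 <= q.1 -> z < c.1 -> e c = e q}.

(* The items satisfying [B] are consecutive, and [e] is constant on them, so
   that crossing the whole block costs one gap. *)
Lemma sum_of_gaps T c : path le_fst c T -> c \in l :: T0 ->
    {subset T <= T0} -> {in T0, forall p, (p.1 <= c.1) || (p \in T)} ->
  (f r <= e c + ((count (predC B) T).+1 + (c.1 <= z)%O) * h
          + count (predC B) T)%N.
Proof.
elim: T c => [|q T IH] c /=.
  move=> _ cT0 _ below.
  have : (f r <= e c + h)%N.
    apply: narrow; rewrite ?mem_head // ?lt_r // => p Tp.
    by have := below p Tp; rewrite orbF => ->.
  lia.
move=> /andP[cq pT] cT0 sub below.
have T0q : q \in T0 by apply: sub; rewrite mem_head.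
have {}IH : (f r <= e q + ((count (predC B) T).+1 + (q.1 <= z)%O) * h
          + count (predC B) T)%N.
  apply: IH; rewrite ?inE ?T0q ?orbT //.
    by move=> p Tp; apply: sub; rewrite inE Tp orbT.
  move=> p /below; rewrite inE => /or3P[pc|/eqP->|->]; rewrite ?orbT //.
    by rewrite (le_trans pc cq).
  by rewrite lexx.
have zmono : ((q.1 <= z)%O <= (c.1 <= z)%O)%N.
  by have [qz|//] := boolP (q.1 <= z); rewrite (le_trans cq qz).
have := cq; rewrite /le_fst /= le_eqVlt => /predU1P[eq1|lt1].
  by rewrite (e_fst eq1) eq1; nia.
have nar : (f q <= e c + h)%N.
  apply: narrow; rewrite ?inE ?T0q ?orbT // => p /below.
  case/orP=> [->//|]; rewrite inE => /predU1P[->|Tp].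
    by rewrite lexx orbT.
  have := allP (order_path_min le_fst_trans pT) p Tp.
  by rewrite /le_fst /= => ->; rewrite orbT.
have [Bq|nBq] := boolP (B q); last first.
  have := dominated T0q nBq.
  nia.
have bq : (q.1 <= z) = false by apply: lt_geF; apply: block_gt.
rewrite bq in IH.
(* Entering the block uses up the [h] reserved by the summand [c.1 <= z]; after that, steps within
   the block are free. *)
have [cz|zc] := leP c.1 z.
  have := block_dominated T0q Bq; lia.
rewrite (block_const cT0 T0q Bq (ltW lt1) zc) /=; lia.
Qed.

End Pigeonhole.

Lemma pair_le_trans p q c : pair_le p q -> pair_le q c -> pair_le p c.
Proof.
move=> /andP[a1 a2] /andP[b1 b2].
by rewrite /pair_le (le_trans a1 b1) (le_trans a2 b2).
Qed.

Lemma pair_ltW p q : pair_lt p q -> pair_le p q.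
Proof. by move=> /andP[a1 a2]; rewrite /pair_le !ltW. Qed.

Lemma pair_lt_le_trans p q c : pair_lt p q -> pair_le q c -> pair_lt p c.
Proof.
move=> /andP[a1 a2] /andP[b1 b2].
by rewrite /pair_lt (lt_le_trans a1 b1) (lt_le_trans a2 b2).
Qed.

Lemma pair_le_lt_trans p q c : pair_le p q -> pair_lt q c -> pair_lt p c.
Proof.
move=> /andP[a1 a2] /andP[b1 b2].
by rewrite /pair_lt (le_lt_trans a1 b1) (le_lt_trans a2 b2).
Qed.

Lemma insideE l r x : inside l r x = pair_lt l x && pair_lt x r.
Proof. by rewrite /inside /pair_lt andbACA. Qed.

Lemma inside_widen l r l' r' x : pair_le l l' -> pair_le r' r ->
  inside l' r' x -> inside l r x.
Proof.
move=> ll' rr'; rewrite !insideE => /andP[lx xr].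
by rewrite (pair_le_lt_trans ll' lx) (pair_lt_le_trans xr rr').
Qed.

Lemma pair_le_refl p : pair_le p p.
Proof. by rewrite /pair_le !lexx. Qed.
#[local] Hint Resolve pair_le_refl : core.

Lemma count_le1_inside l r w a : {in w, forall x, inside l r x} ->
  a <= l.1 -> count_le1 a w = 0%N.
Proof.
move=> ins al; apply/eqP; rewrite -leqn0 leqNgt -has_count.
apply/hasPn => x /ins /andP[/andP[lx _] _] /=.
by rewrite -ltNge (le_lt_trans al).
Qed.

Lemma count_lt2_inside l r w a : {in w, forall x, inside l r x} ->
  r.2 <= a -> count_lt2 a w = size w.
Proof.
move=> ins ra; apply/eqP; rewrite -all_count; apply/allP => x.
by move=> /ins /andP[_ /andP[_ xr]] /=; apply: lt_le_trans ra.
Qed.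

Lemma count_proper (T : eqType) (a b : pred T) (s : seq T) (y : T) :
  subpred a b -> y \in s -> b y -> ~~ a y -> (count a s < count b s)%N.
Proof.
move=> sub; elim: s => //= z s IH; rewrite inE => /predU1P[<-|ys] by_ nay.
  by rewrite by_ (negbTE nay) ltnS sub_count.
have := IH ys by_ nay; have := sub z.
by case: (a z) => [->//|_]; case: (b z) => /=; lia.
Qed.

Lemma count_le1_cat a w w' :
  count_le1 a (w ++ w') = (count_le1 a w + count_le1 a w')%N.
Proof. exact: count_cat. Qed.

Lemma count_le2_cat a w w' :
  count_le2 a (w ++ w') = (count_le2 a w + count_le2 a w')%N.
Proof. exact: count_cat. Qed.

Lemma count_lt2_cat a w w' :
  count_lt2 a (w ++ w') = (count_lt2 a w + count_lt2 a w')%N.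
Proof. exact: count_cat. Qed.

(** If no gap between neighbouring stored pairs were wider than [h], adding up the gaps from [l] to
    [r] would bound [size w1]. Pairs stored within [(l1, r1)] cost only one gap in total, because
    [w1] has no items there. *)
Lemma wide_gap l r l1 r1 w1 w2 M h :
    pair_lt l r -> pair_le l l1 -> pair_le r1 r -> coherent M ->
    {in M, forall p, ~~ inside l r p -> pair_le p l || pair_le r p} ->
    {in M, forall p, inside l r p ->
       [|| inside l1 r1 p && (p \in w2), pair_le p l1 | pair_le r1 p]} ->
    {in w1, forall x, inside l r x} -> {in w2, forall x, inside l1 r1 x} ->
    avoids l1 r1 w1 -> (count_le1 l1.1 w1 <= count_le2 l1.2 w1)%N ->
    {in M, forall p, inside l r p -> ~~ inside l1 r1 p ->
       count_le1 p.1 w1 <= (count_lt2 p.2 w1).+1}%N ->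
    rank_dominated l1 r1 w2 M ->
  let m := size (undup [seq p <- M | inside l r p && ~~ inside l1 r1 p]) in
    ((m + 2) * h + m < size w1)%N ->
  exists g l' r', (h < g)%N /\ is_gap l r (w1 ++ w2) M g l' r'.
Proof.
move=> lr ll1 r1r coh Mout Mblock ins1 ins2 av1 dom0 dom1 dom2 m hm.
apply: contrapT => nogap.
pose T0 := undup [seq p <- M | inside l r p].
have T0E p : (p \in T0) = inside l r p && (p \in M).
  by rewrite mem_undup mem_filter.
have T0l p : p \in T0 -> pair_lt l p by rewrite T0E insideE => /andP[/andP[]].
have T0r p : p \in T0 -> pair_lt p r by rewrite T0E insideE => /andP[/andP[]].
have lt12 c q : c \in l :: T0 -> q \in r :: T0 -> c.1 < q.1 -> c.2 < q.2.
  rewrite !inE => /predU1P[->|cT0] /predU1P[->|qT0].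
  - by case/andP: lr.
  - by case/andP: (T0l q qT0).
  - by case/andP: (T0r c cT0).
  - move: cT0 qT0; rewrite !T0E => /andP[_ cM] /andP[_ qM].
    by rewrite !ltNge coh.
have narrow c q : c \in l :: T0 -> q \in r :: T0 -> c.1 < q.1 ->
    {in T0, forall p, (p.1 <= c.1) || (q.1 <= p.1)} ->
    (count_lt2 q.2 w1 <= count_le1 c.1 w1 + h)%N.
  move=> cT qT cq1 cons; rewrite leqNgt; apply/negP => wide; apply: nogap.
  have cq2 := lt12 c q cT qT cq1.
  have lc : pair_le l c.
    by move: cT; rewrite inE => /predU1P[->|/T0l/pair_ltW].
  have qr : pair_le q r.
    by move: qT; rewrite inE => /predU1P[->|/T0r/pair_ltW].
  have sep : separates c q M.
    move=> p Mp.
    have [insp|/(Mout p Mp)/orP[pl|rp]] := boolP (inside l r p); last 2 first.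
    - by apply/orP; left; apply: pair_le_trans pl lc.
    - by apply/orP; right; apply: pair_le_trans qr rp.
    have T0p : p \in T0 by rewrite T0E insp.
    have [pc|qp] := orP (cons p T0p); apply/orP; [left|right].
      rewrite /pair_le pc /= leNgt; apply/negP.
      move: cT; rewrite inE => /predU1P[cl|cT0].
        by case/andP: (T0l p T0p) => lp1; rewrite cl leNgt lp1 in pc.
      move: cT0; rewrite T0E => /andP[_ cM].
      by rewrite ltNge -coh // pc.
    rewrite /pair_le qp /= leNgt; apply/negP.
    move: qT; rewrite inE => /predU1P[qer|qT0].
      by case/andP: (T0r p T0p) => pr1; rewrite qer leNgt pr1 in qp.
    move: qT0; rewrite T0E => /andP[_ qM].
    by rewrite ltNge -coh // qp.
  (* The items of [w2] can only widen a gap. If [c] lies in the block, the extra one in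
     [rank_dominated] is absorbed because [c] itself is below [q]. *)
  have wide2 : (count_le1 c.1 w2 <= count_lt2 q.2 w2)%N.
    have c_below : pair_le c l1 -> count_le1 c.1 w2 = 0%N.
      by case/andP=> cl1 _; apply: count_le1_inside ins2 cl1.
    move: (cT); rewrite inE => /predU1P[cl|cT0]; first by rewrite c_below // cl.
    have cM : c \in M by move: cT0; rewrite T0E => /andP[].
    have cins : inside l r c by move: cT0; rewrite T0E => /andP[].
    have /or3P[/andP[cblock cw2]|/c_below->//|/andP[_ rc2]] := Mblock c cM cins.
      apply: leq_trans (dom2 c cM cblock) _.
      apply: (count_proper (y := c)) => //= [x /= xc|]; last by rewrite ltxx.
      exact: lt_trans cq2.
    rewrite (count_lt2_inside ins2 (le_trans rc2 (ltW cq2))).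
    exact: count_size.
  pose g := (count_lt2 q.2 (w1 ++ w2) - count_le1 c.1 (w1 ++ w2))%N.
  have widthE : count_lt2 q.2 (w1 ++ w2) = (count_le1 c.1 (w1 ++ w2) + g)%N.
    rewrite /g subnKC // count_le1_cat count_lt2_cat leq_add //.
    exact: leq_trans (leq_addr h _) (ltnW wide).
  have cq : pair_lt c q by rewrite /pair_lt cq1.
  have [l' [r' gap]] := gap_between lc qr cq sep widthE.
  exists g, l', r'; split=> //.
  by rewrite /g ltn_subRL count_le1_cat count_lt2_cat addnAC -addSn leq_add.
have block_le1 a : l1.1 <= a -> a < r1.1 -> count_le1 a w1 = count_le1 l1.1 w1.
  exact: count_le1_avoids.
(* Only [w1] is counted: the rank is [0] at [l] and [size w1] at [r]. *)
have := @sum_of_gaps (fun c => count_le1 c.1 w1)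
  (fun q => count_lt2 q.2 w1) (inside l1 r1) l1.1 l r h T0 _ narrow _ _ _ _ _
  (sort le_fst T0) l.
rewrite (count_lt2_inside ins1 (lexx _)) (count_le1_inside ins1 (lexx _)).
have -> : count (predC (inside l1 r1)) (sort le_fst T0) = m.
  rewrite count_sort -size_filter /T0 filter_undup -filter_predI.
  by congr (size (undup _)); apply: eq_filter => p /=; rewrite andbC.
have -> : l.1 <= l1.1 by case/andP: ll1.
have bound : ~ (size w1 <= 0 + (m.+1 + true) * h + m)%N by lia.
move=> sum; apply: bound; apply: sum.
- by move=> c q ->.
- move=> p; rewrite inE => /predU1P[->|/T0r/andP[]//].
  by case/andP: lr.
- by move=> q; rewrite T0E => /andP[insq Mq] nBq; apply: dom1.
- move=> q _; rewrite insideE => /andP[/andP[lq1 lq2] /andP[qr1 qr2]].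
  by rewrite block_le1 ?ltW // (count_lt2_avoids av1).
- by move=> q _ /andP[/andP[]].
- move=> c q _ _ /andP[/andP[l1q qr1] _] cq l1c.
  by rewrite !block_le1 ?ltW // (le_lt_trans cq).
- rewrite path_min_sorted; first by apply: sort_sorted => p q; apply: le_total.
  by apply/allP => p; rewrite mem_sort => /T0l/andP[/ltW].
- exact: mem_head.
- by move=> p; rewrite mem_sort.
- by move=> p T0p; rewrite mem_sort T0p orbT.
Qed.

(** * Batches of increasing pairs *)

Section Batch.
Hypothesis dense : forall a b : U, a < b -> exists u, a < u < b.

Lemma increasing_batch n l r : pair_lt l r -> exists w,
  [/\ size w = n, {in w, forall x, inside l r x}, coherent w
    & {in w, forall p, count_le1 p.1 w <= (count_lt2 p.2 w).+1}%N].
Proof.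
elim: n l => [|n IH] l lr; first by exists [::].
have /andP[lr1 lr2] := lr.
have [a1 /andP[la1 ar1]] := dense lr1; have [a2 /andP[la2 ar2]] := dense lr2.
have [|w [szw insw cohw domw]] := IH (a1, a2); first by rewrite /pair_lt ar1.
have aw x : x \in w -> (a1 < x.1) /\ (a2 < x.2).
  by move=> /insw; rewrite insideE => /andP[/andP[]].
exists ((a1, a2) :: w); split=> /=.
- by rewrite szw.
- move=> x; rewrite inE => /predU1P[->|/insw].
    by rewrite insideE /pair_lt /= la1 la2 ar1 ar2.
  by apply: inside_widen; rewrite /pair_le /= ?lexx ?ltW.
- move=> p q; rewrite !inE => /predU1P[->|wp] /predU1P[->|wq] /=.
  + by rewrite !lexx.
  + by have [/ltW-> /ltW->] := aw q wq.
  + by have [/lt_geF-> /lt_geF->] := aw p wp.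
  + exact: cohw.
- move=> p; rewrite inE => /predU1P[->|wp] /=.
    rewrite lexx add1n ltnS; apply: leq_trans (leq0n _).
    rewrite leqn0 eqn0Ngt -has_count.
    by apply/hasPn => x /aw[ax _] /=; rewrite -ltNge.
  have [pa1 pa2] := aw p wp; rewrite (ltW pa1) pa2 !add1n ltnS.
  exact: domw.
Qed.

End Batch.
End Gaps.

(** * The recursive adversary *)

Section Adversary.
Context {R : Type} (D : comparison_based R).
Context {d : Order.disp_t} {U : orderType d}.
Implicit Types (w M T : seq (U * U)) (x p q c l r : U * U).
Local Open Scope order_scope.
Variables N n : nat.
Hypothesis dense : forall a b : U, a < b -> exists u, a < u < b.
Hypothesis small : forall v : seq U, (size v <= N)%N ->
  (size (run D N v).1 < n)%N.
Let memory w := stored D N w.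

Lemma size_stored w : (size w <= N)%N -> (size (memory w) < n)%N.
Proof.
move=> wN; have := small (v := unzip1 w); rewrite size_map => /(_ wN).
by rewrite run_unzip1 size_map.
Qed.

(** A width never exceeds [size w], so a largest one exists. Its maximality turns [wide_gap] into a
    lower bound on the number of stored pairs. *)
Lemma max_gap l r w M g0 l0 r0 : is_gap l r w M g0 l0 r0 ->
  exists g l' r', [/\ is_gap l r w M g l' r', (g0 <= g)%N
    & forall g1 l1 r1, is_gap l r w M g1 l1 r1 -> (g1 <= g)%N].
Proof.
move=> gap0.
pose P g := `[< exists l' r', is_gap l r w M g l' r' >].
have exP : exists g, P g by exists g0; apply/asboolP; exists l0, r0.
have leP g : P g -> (g <= size w)%N.
  move=> /asboolP[l' [r' [_ _ _ _ _ wid]]].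
  apply: leq_trans (count_size (fun x => x.2 <= l'.2) w).
  by rewrite -/(count_le2 l'.2 w) wid leq_addl.
case: (ex_maxnP exP leP) => g /asboolP[l' [r' gap]] maxg.
exists g, l', r'; split=> // [|g1 l1 r1 gap1]; apply: maxg; apply/asboolP.
  by exists l0, r0.
by exists l1, r1.
Qed.

(* Distinct items are counted, because the item array may duplicate its items. *)
Definition stored_space l r w :=
  size (undup [seq p <- memory w | inside l r p]).

Lemma stored_new w0 w l r : separates l r (memory w0) ->
    {in w, forall x, inside l r x} ->
  {in memory (w0 ++ w), forall p, if inside l r p then p \in w
     else (p \in memory w0) && (pair_le p l || pair_le r p)}.
Proof.
move=> sep ins p /stored_cat; rewrite mem_cat.
case/orP=> [Mp|wp]; last by rewrite ins.
have side : pair_le p l || pair_le r p by exact: sep.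
case: ifP => [|_]; last by rewrite Mp.
rewrite insideE => /andP[/andP[lp _] /andP[pr _]].
by case/orP: side => /andP[+ _]; rewrite leNgt ?lp ?pr.
Qed.

(** The induction ranges over all [w0] and [(l, r)], because the second run starts from the memory
    left by the first. Space is measured after a prefix [take i w], since items may be discarded
    later, and only inside [(l, r)], so that contributions from inside and outside the inner gap can
    be added. *)
Lemma adversary k w0 l r : twin D N w0 -> pair_lt l r ->
    separates l r (memory w0) -> (size w0 + 2 ^ k * n <= N)%N ->
  exists w g i l' r',
   [/\ size w = (2 ^ k * n)%N, {in w, forall x, inside l r x},
    twin D N (w0 ++ w), rank_dominated l r w (memory (w0 ++ w))
    & [/\ is_gap l r w (memory (w0 ++ w)) g l' r', (0 < g)%N
    & (k * (2 ^ k * n) <= 8 * g * (stored_space l r (w0 ++ take i w) + k))%N]].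
Proof.
elim: k w0 l r => [|k IH] w0 l r tw0 lr sep0 szN.
  have [w [szw insw cohw domw]] := increasing_batch dense n lr.
  have twin_w : twin D N (w0 ++ w) := twin_cat tw0 sep0 insw cohw.
  have new := stored_new sep0 insw.
  have dom : rank_dominated l r w (memory (w0 ++ w)).
    by move=> p /new + insp; rewrite insp; apply: domw.
  (* With the empty block [(l, l)] and [h = 0]: fewer than [n] of the [n] items are stored, so some
     gap has positive width. *)
  have [|||||||||g [l' [r' [g_gt0 gap]]]] := @wide_gap d U l r l l w [::]
    (memory (w0 ++ w)) 0 lr (pair_le_refl l) (pair_ltW lr) twin_w.2.
  - by move=> p /new + /negbTE ninsp; rewrite ninsp => /andP[].
  - move=> p _; rewrite insideE => /andP[lp _]; apply/or3P; apply: Or33.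
    exact: pair_ltW.
  - exact: insw.
  - by [].
  - by move=> x _; rewrite !lt_asym.
  - by rewrite (count_le1_inside insw).
  - by move=> p Mp insp _; apply: dom.
  - by [].
  - rewrite muln0 add0n szw.
    apply: leq_ltn_trans (size_stored (w := w0 ++ w) _).
      by apply: leq_trans (size_undup _) _; rewrite size_filter count_size.
    by rewrite size_cat szw -(mul1n n).
  (* For [k = 0] the left side of the space bound vanishes, so any moment will do. *)
  exists w, g, 0%N, l', r'; split=> //; first by rewrite mul1n.
  by rewrite cats0 in gap; split.
have [|w1 [g1 [i1 [l1 [r1 [sz1 ins1 tw1 dom1 [gap1 g1_gt0 sp1]]]]]]] :=
    IH w0 l r tw0 lr sep0.
  by rewrite expnS in szN; lia.
have [ll1 r1r l1r1 sep1 av1 wid1] := gap1.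
have [|w2 [g2 [i2 [l2 [r2 [sz2 ins2 tw2 dom2 [gap2 g2_gt0 sp2]]]]]]] :=
    IH (w0 ++ w1) l1 r1 tw1 l1r1 sep1.
  by rewrite size_cat sz1; rewrite expnS in szN; lia.
have [l1l2 r2r1 l2r2 sep2 av2 wid2] := gap2.
rewrite -catA in tw2 dom2 gap2 sep2.
set w := w1 ++ w2 in tw2 dom2 gap2 sep2.
have insw : {in w, forall x, inside l r x}.
  move=> x; rewrite mem_cat => /orP[/ins1//|/ins2].
  exact: inside_widen.
have new1 := stored_new sep0 ins1; have new := stored_new sep0 insw.
have new2 := stored_new sep1 ins2; rewrite -catA -/w in new2.
have w2_le1 p : pair_le p l1 -> count_le1 p.1 w2 = 0%N.
  by case/andP=> pl _; apply: count_le1_inside ins2 pl.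
have w2_lt2 p : pair_le r1 p -> count_lt2 p.2 w2 = size w2.
  by case/andP=> _ rp; apply: count_lt2_inside ins2 rp.
have domw1 p : p \in memory (w0 ++ w) -> inside l r p -> ~~ inside l1 r1 p ->
    (count_le1 p.1 w1 <= (count_lt2 p.2 w1).+1)%N.
  move=> /new2 + insp /negbTE nins; rewrite nins => /andP[Mp _].
  exact: dom1.
have dom : rank_dominated l r w (memory (w0 ++ w)).
  move=> p Mp insp; rewrite count_le1_cat count_lt2_cat.
  have := new2 p Mp; have [blk _|nblk /andP[_ side]] := boolP (inside l1 r1 p).
    have := dom2 p Mp blk; move: blk.
    rewrite insideE => /andP[/andP[lp1 lp2] /andP[pr1 pr2]].
    rewrite (count_le1_avoids av1 (ltW lp1) pr1) (count_lt2_avoids av1 lp2 pr2).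
    by rewrite wid1 -addnS => le2; apply: leq_add (leq_addr _ _) le2.
  have := domw1 p Mp insp nblk.
  case/orP: side => [/w2_le1->|/w2_lt2->].
    by rewrite addn0 => /leq_trans; apply; rewrite ltnS leq_addr.
  by rewrite -addSn => le1; apply: leq_add le1 (count_size _ _).
(* The inner gap of the second run is a gap for the whole run, and the surplus [g1] of the first run
   is constant across it, so the widths add. *)
have gap12 : is_gap l r w (memory (w0 ++ w)) (g1 + g2)%N l2 r2.
  have [l1l2_1 l1l2_2] := andP l1l2; have [r2r1_1 r2r1_2] := andP r2r1.
  have [l2r2_1 l2r2_2] := andP l2r2.
  split=> //.
  - exact: pair_le_trans ll1 l1l2.
  - exact: pair_le_trans r2r1 r1r.
  - move=> x; rewrite mem_cat => /orP[/av1/andP[a1 a2]|/av2//].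
    apply/andP; split.
      apply: contra a1 => /andP[lx xr].
      by rewrite (le_lt_trans l1l2_1 lx) (lt_le_trans xr r2r1_1).
    apply: contra a2 => /andP[lx xr].
    by rewrite (le_lt_trans l1l2_2 lx) (lt_le_trans xr r2r1_2).
  rewrite count_le1_cat count_le2_cat wid2.
  rewrite (count_le1_avoids av1 l1l2_1 (lt_le_trans l2r2_1 r2r1_1)).
  rewrite (count_le2_avoids av1 l1l2_2 (lt_le_trans l2r2_2 r2r1_2)).
  by rewrite wid1 addnACA.
have [g [l' [r' [gap le_g max_g]]]] := max_gap gap12.
pose m := size (undup
  [seq p <- memory (w0 ++ w) | inside l r p && ~~ inside l1 r1 p]).
(* Otherwise [wide_gap] with [h = g] yields a gap wider than the largest one. *)
have le_n1 : (2 ^ k * n <= (m + 2) * g + m)%N.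
  rewrite leqNgt -sz1; apply/negP => lt_n1.
  have [|||g' [l3 [r3 [lt_g gap']]]] := wide_gap lr ll1 r1r tw2.2 _ _ ins1 ins2
    av1 _ domw1 dom2 lt_n1.
  - by move=> p /new + /negbTE nins; rewrite nins => /andP[].
  - move=> p /new2; case: ifP => [_ -> //|_ /andP[_ side] _].
    by rewrite side orbT.
  - by rewrite wid1 leq_addr.
  by have := max_g _ _ _ gap'; rewrite leqNgt lt_g.
have g_gt0 : (0 < g)%N by lia.
have szw : size w = (2 ^ k.+1 * n)%N by rewrite size_cat sz1 sz2 expnS; lia.
have [] := space_gap_arith le_g g1_gt0 sp1 sp2 le_n1 => bound.
  (* The moment lies in the first run; the minimum keeps the prefix within [w1]. *)
  exists w, g, (minn i1 (size w1)), l', r'; split=> //; split=> //.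
  rewrite takel_cat ?geq_minr // take_min take_size.
  by rewrite expnS -mulnA.
exists w, g, (size w1 + i2)%N, l', r'; split=> //; split=> //.
rewrite take_cat ltnNge leq_addr /= addKn expnS -mulnA.
apply: leq_trans bound _; rewrite leq_mul2l leq_add2r; apply/orP; right.
rewrite -catA /stored_space.
set v := take i2 w2; set M' := memory _.
set V := undup [seq p <- M' | inside l r p].
(* Pairs outside the inner gap that are stored at the end were already stored at this moment, since
   all later arrivals lie inside the inner gap. *)
have m_le : (m <= size [seq p <- V | ~~ inside l1 r1 p])%N.
  apply: uniq_leq_size; first exact: undup_uniq.
  move=> p; rewrite mem_undup !mem_filter mem_undup mem_filter.
  case/andP=> /andP[-> nblk]; rewrite nblk /=.
  have -> : w0 ++ w = (w0 ++ w1 ++ v) ++ drop i2 w2.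
    by rewrite -!catA cat_take_drop.
  move=> /stored_cat; rewrite mem_cat => /orP[//|/mem_drop/ins2 blk].
  by rewrite blk in nblk.
have -> : [seq p <- M' | inside l1 r1 p]
          = [seq p <- [seq p <- M' | inside l r p] | inside l1 r1 p].
  rewrite -filter_predI; apply: eq_filter => p /=.
  by have [/(inside_widen ll1 r1r)->|] := boolP (inside l1 r1 p).
rewrite -filter_undup -/V size_filter -(count_predC (inside l1 r1) V).
by rewrite leq_add2l -size_filter.
Qed.

End Adversary.

(** * From wide gaps to the space bound *)

Local Open Scope classical_set_scope.
Local Open Scope ring_scope.

Lemma cmps_separated (d : Order.disp_t) (U : orderType d) (l r q : U * U)
    (M : seq (U * U)) : separates l r M -> inside l r q ->
  cmps q.1 (unzip1 M) = cmps q.2 (unzip2 M).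
Proof.
move=> sep /andP[/andP[lq1 qr1] /andP[lq2 qr2]].
rewrite /cmps /unzip1 /unzip2 -!map_comp; apply/eq_in_map => p /sep /=.
rewrite /cmp => /orP[] /andP[p1 p2].
  have lt1 := le_lt_trans p1 lq1; have lt2 := le_lt_trans p2 lq2.
  by rewrite !(lt_gtF lt1, lt_gtF lt2, gt_eqF lt1, gt_eqF lt2).
by rewrite (lt_le_trans qr1 p1) (lt_le_trans qr2 p2).
Qed.

(** Queries inside the gap receive one common answer from both streams, although their ranks differ
    by [g]; each rank is within [eps N] of that answer. *)
Lemma gap_le_error (R : realType) (eps : R) (d : Order.disp_t) (U : orderType d)
    (D : comparison_based R) (w : seq (U * U)) g (l r l' r' : U * U) :
    estimates_rank eps U D ->
    (forall a b : U, (a < b)%O -> exists u, (a < u < b)%O) ->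
    twin D (size w) w -> is_gap l r w (stored D (size w) w) g l' r' ->
  g%:R <= 2 * eps * (size w)%:R.
Proof.
move=> est dense [run2 _] [_ _ /andP[lr1 lr2] sep av wid].
have [q1 q1in] := dense _ _ lr1; have [q2 q2in] := dense _ _ lr2.
have := est (unzip1 w) q1; have := est (unzip2 w) q2.
rewrite /run_query !size_map run2 run_unzip1.
have -> : cmps q2 (unzip2 (stored D (size w) w)) =
          cmps q1 (unzip1 (stored D (size w) w)).
  by rewrite -(@cmps_separated d U l' r' (q1, q2)) // /inside q1in q2in.
set a := answer _ _.
rewrite !count_map.
rewrite -[count (preim fst _) w]/(count_le1 q1 w).
rewrite -[count (preim snd _) w]/(count_le2 q2 w).
case/andP: q1in => lq1 qr1; case/andP: q2in => lq2 qr2.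
rewrite (count_le1_avoids av (ltW lq1) qr1) (count_le2_avoids av (ltW lq2) qr2).
rewrite wid natrD !ler_norml => /andP[h1 h2] /andP[h3 h4]; lra.
Qed.

(** The constant 16 comes from inserting [g <= 2 eps N] into [k N <= 8 g (s + k)] and dividing by
    [N]. *)
Lemma space_lower_bound (R : realType) (eps : R) (d : Order.disp_t)
    (U : orderType d) (D : comparison_based R) (n k : nat) :
    unbounded_continuous U -> estimates_rank eps U D -> (0 < n)%N ->
    (forall v : seq U, (size v <= 2 ^ k * n)%N ->
      (size (run D (2 ^ k * n) v).1 < n)%N) ->
  exists2 v : seq U, (size v <= 2 ^ k * n)%N &
    k%:R <= 16 * eps * ((size (run D (2 ^ k * n) v).1)%:R + k%:R).
Proof.
move=> [[a] _ noMax between] est n_gt0 small.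
have dense (x y : U) : (x < y)%O -> exists u, (x < u < y)%O.
  move=> /(between x y 1%N)[[|u s] [_ szs su]] //; exists u.
  by apply: su; rewrite mem_head.
have [b ab] := noMax a.
have lr : pair_lt (a, a) (b, b) by rewrite /pair_lt ab.
have twin0 : twin D (2 ^ k * n) ([::] : seq (U * U)) by split.
have sep0 : separates (a, a) (b, b)
    (stored D (2 ^ k * n) ([::] : seq (U * U))) by [].
have [w [g [i [l' [r' [szw _ tw _ [gap g_gt0 bound]]]]]]] :=
  adversary dense small twin0 lr sep0 (leqnn _).
rewrite /= -szw in tw gap bound *.
have le_g := gap_le_error est dense tw gap.
exists (unzip1 (take i w)); first by rewrite size_map size_take_min geq_minr.
rewrite run_unzip1 /= size_map.
set s := size _.
have sp : (stored_space D (size w) (a, a) (b, b) (take i w) <= s)%N.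
  by apply: leq_trans (size_undup _) _; rewrite size_filter count_size.
have N_gt0 : (0 : R) < (size w)%:R.
  by rewrite ltr0n szw muln_gt0 expn_gt0.
have {}bound : (k * size w <= 8 * g * (s + k))%N.
  by apply: leq_trans bound _; rewrite leq_mul2l leq_add2r sp orbT.
rewrite -(ler_pM2r N_gt0) -natrM.
apply: (@le_trans _ _ (8 * g * (s + k))%:R); first by rewrite ler_nat.
rewrite !natrM natrD.
have : g%:R * (s%:R + k%:R) <= 2 * eps * (size w)%:R * (s%:R + k%:R) :> R.
  by rewrite ler_wpM2r // addr_ge0.
lra.
Qed.

Theorem theorem3 (R : realType) (eps : R) (d : Order.disp_t) (U : orderType d)
    (eps_gt0 : 0 < eps) (eps_lt : eps < 1 / 16)
    (U_uc : unbounded_continuous U) :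
  ~ exists (D : comparison_based R) (f : nat -> R^o),
      [/\ estimates_rank eps U D,
          stores_at_most U D f
        & f =o_\oo (fun N : nat => (1 / eps * ln (eps * N%:R) : R^o))].
Proof.
move=> [D [f [est store /eqoP small_o]]].
(* The final contradiction needs [16 * 7 * c < 1 - 16 eps], where 7 bounds [ln 8]; 256 exceeds
   112. *)
pose c := (1 - 16 * eps) / 256.
have c_gt0 : 0 < c by rewrite /c; lra.
have [M _ f_small] := small_o c c_gt0.
(* Beyond the threshold [M] of the little-o, [k >= 1 / eps] ensures [eps N >= 1], so that the
   logarithm is non-negative, and [k / eps <= k * k < 4 ^ k]. *)
pose k := maxn M (Num.bound eps^-1).+1.
have k_ge : eps^-1 <= k%:R.
  apply: le_trans (ltW (archi_boundP _)) _; first by rewrite invr_ge0 ltW.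
  by rewrite ler_nat /k; lia.
have k_gt0 : (0 < k)%N by rewrite /k; lia.
pose N := (2 ^ k * 4 ^ k)%N.
have NE : N = (8 ^ k)%N by rewrite /N -expnMn.
have k_lt8 : (k < 8 ^ k)%N by apply: ltn_expl.
have fN : f N <= 7 * c * (k%:R / eps).
  have /= := f_small N; rewrite NE => /(_ _)/le_trans-/(_ _ _) fle.
  apply: le_trans (ler_norm _) _; apply: fle.
    by apply: leq_trans (ltnW k_lt8); apply: leq_maxl.
  have epsN_ge1 : 1 <= eps * (8 ^ k)%:R.
    rewrite -ler_pdivrMl // mulr1; apply: le_trans k_ge _.
    by rewrite ler_nat ltnW.
  rewrite ger0_norm; last by rewrite mulr_ge0 ?ln_ge0 // ltW // divr_gt0.
  have ln_le : ln (eps * (8 ^ k)%:R) <= 7 * k%:R.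
    apply: (@le_trans _ _ (ln ((8 ^ k)%:R : R))).
      rewrite ler_ln ?posrE ?mulr_gt0 ?ltr0n ?expn_gt0 //.
      by rewrite ler_piMl //; lra.
    rewrite natrX lnXn // -[X in X <= _]mulr_natr ler_wpM2r //.
    have := @le_ln1Dx R 7; rewrite (_ : 1 + 7 = 8); last by ring.
    by apply; lra.
  have -> : 7 * c * (k%:R / eps) = c * (eps^-1 * (7 * k%:R)) by ring.
  by rewrite div1r !ler_pM2l ?invr_gt0.
(* The space bound is about prefixes of streams of length [N], so [v] is padded with copies of an
   arbitrary item. *)
have run_le (v : seq U) : (size v <= N)%N -> (size (run D N v).1)%:R <= f N.
  move=> vN; have [[a] _ _ _] := U_uc.
  have := store (v ++ nseq (N - size v) a) (size v).
  rewrite size_cat size_nseq subnKC // => /(_ vN).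
  by rewrite take_size_cat.
have [||v vN] := @space_lower_bound R eps d U D (4 ^ k) k U_uc est.
- by rewrite expn_gt0.
(* The memory stays below the batch size: [f N <= 7 c k / eps <= k / eps <= k * k < 4 ^ k]. *)
- move=> v /run_le le_f; rewrite -(ltr_nat R).
  apply: le_lt_trans le_f _; apply: le_lt_trans fN _.
  have lt4 : (k * k < 4 ^ k)%N.
    have -> : (4 ^ k = 2 ^ k * 2 ^ k)%N by rewrite -expnMn.
    by rewrite ltn_mul // ltn_expl.
  apply: (@le_lt_trans _ _ (k * k)%:R); last by rewrite ltr_nat.
  rewrite natrM; apply: (@le_trans _ _ (1 * (k%:R / eps))).
    by rewrite ler_wpM2r ?divr_ge0 ?(ltW eps_gt0) // /c; lra.
  by rewrite mul1r ler_wpM2l.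
have := run_le v vN; rewrite -/N; set s := _%:R => s_le k_le.
have {}s_le : s * eps <= 7 * c * k%:R.
  by rewrite -ler_pdivlMr // -(mulrA (7 * c)); apply: le_trans s_le fN.
have k_pos : 0 < k%:R :> R by rewrite ltr0n.
have : k%:R * (1 - 16 * eps) <= 16 * (7 * c * k%:R) by lra.
have : 0 < k%:R * (1 - 16 * eps) by rewrite mulr_gt0 //; lra.
rewrite /c; lra.
Qed.
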